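(* Let $k\geq 5$ and $1\leq m\leq\sqrt{k}$ be integers. Then for every real $\phi$ with $0<\phi<\frac{1}{2}$ and every $\mu\in\mathcal{M}_{\phi}$, one has $F_{k,m}(\mu)>0$.
   Context: $\log$ is the natural logarithm, with the convention $0\log 0=0$. For $\phi\in[0,1]$, $\mathcal{M}_{\phi}$ is the set of (Borel) probability measures $\mu$ on $[0,1]$ with $\mathbb{E}_{x\sim\mu}[x]=\phi$. For integers $k,m\geq 1$ and $t,x,y\in[0,1/k]$ define \[h_{k,m}(t):=-kt\log t-(1-kt)\log(1-kt)+(1-kt)\log m\] and \begin{align*}g_{k,m}(x,y):=&-(1-kx)(1-ky)\log\big((1-kx)(1-ky)\big)\\&-\Big(x+y+\big(\tfrac{k(k-1)}{2}-1\big)xy\Big)\log\Big(x+y+\big(\tfrac{k(k-1)}{2}-1\big)xy\Big)\\&-\sum_{j=1}^{k-1}\big(x+y-(2k-j+1)xy\big)\log\big(x+y-(2k-j+1)xy\big)+(1-kx)(1-ky)\log m.\end{align*} For a probability measure $\mu$ on $[0,1]$ define \[F_{k,m}(\mu):=\mathbb{E}_{(x,y)\sim\mu\times\mu}\Big[g_{k,m}\big(\tfrac{x}{k},\tfrac{y}{k}\big)\Big]-\mathbb{E}_{x\sim\mu}\Big[h_{k,m}\big(\tfrac{x}{k}\big)\Big].\] *)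

(* Defs.v *)
From HB Require Import structures.
From mathcomp Require Import all_boot all_order all_algebra.
From mathcomp Require Import all_classical all_reals all_analysis.
Set Implicit Arguments.
Unset Strict Implicit.
Unset Printing Implicit Defensive.
Import Order.TTheory GRing.Theory Num.Theory.
Import numFieldNormedType.Exports.
Local Open Scope classical_set_scope.
Local Open Scope ring_scope.

(* The convention 0 log 0 = 0 is automatic, since ln x = 0 for x <= 0. *)
Definition xlogx (R : realType) (x : R) : R := x * ln x.

Definition h_km (R : realType) (k m : nat) (t : R) : R :=
  - (k%:R * t * ln t) - xlogx (1 - k%:R * t) + (1 - k%:R * t) * ln m%:R.

(* For x, y in [0, 1/k] all arguments of xlogx below are nonnegative. *)
Definition g_km (R : realType) (k m : nat) (x y : R) : R :=
  - xlogx ((1 - k%:R * x) * (1 - k%:R * y))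
  - xlogx (x + y + (k%:R * (k%:R - 1) / 2 - 1) * x * y)
  - \sum_(1 <= j < k) xlogx (x + y - (2 * k%:R - j%:R + 1) * x * y)
  + (1 - k%:R * x) * (1 - k%:R * y) * ln m%:R.

(* A Borel probability measure on [0, 1] is encoded as one on the real line
   giving [0, 1] full mass. *)
Definition probs_unit_itv (R : realType) :
    set (probability (measurableTypeR R) R) :=
  [set mu : probability (measurableTypeR R) R | mu `[0 : R, 1 : R]%classic = 1%E].

Definition probs_mean (R : realType) (phi : R) :
    set (probability (measurableTypeR R) R) :=
  [set mu | probs_unit_itv mu /\ ('E_mu[fun x : R => x] = phi%:E)%E].

(* Only meant for mu in probs_unit_itv: the integrands are then bounded almost
   everywhere, so both expectations are finite, and the values of h_km and g_km
   outside [0, 1/k] are irrelevant. *)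
Definition F_km (R : realType) (k m : nat)
    (mu : probability (measurableTypeR R) R) : \bar R :=
  ('E_(mu \x mu)[fun z : R * R => g_km k m (z.1 / k%:R) (z.2 / k%:R)]
   - 'E_mu[fun x : R => h_km k m (x / k%:R)])%E.

(* Main.v *)
Require Import Defs.
From HB Require Import structures.
From mathcomp Require Import all_boot all_order all_algebra.
From mathcomp Require Import all_classical all_reals all_analysis.
From mathcomp Require Import measurable_realfun ring lra.
Set Implicit Arguments.
Unset Strict Implicit.
Unset Printing Implicit Defensive.
Import Order.TTheory GRing.Theory Num.Theory.
Import numFieldNormedType.Exports.
Local Open Scope classical_set_scope.
Local Open Scope ring_scope.

(* Put s = x + y - x y and r = x y / s. The entropy [g_km k m (x / k) (y / k)] equals
   H(s) + s (ln k - Phi(r)) + (1 - s) ln m, where H is the binary entropy and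
   Phi(r) (the [deficit]) is the divergence from uniformity of the law of the nonzero
   outcome, and [h_km k m (x / k)] is H(x) + x ln k + (1 - x) ln m. Two facts on Phi suffice:
   it lies below its chord on [0, 1] by at least 0.69 r (1 - r), and
   Phi(1) + 0.08 <= ln (k / m). The first one and a two-variable inequality bound g
   below pointwise by a function whose mean is explicit, so that
   F >= (1 - 2 phi) E[H - 2 slack] + phi^2 (ln (k / m) - 0.08 - Phi(1))
        + phi (1 - 2 phi) (ln (k / m) - 0.08) > 0.
   The logarithms are eliminated with Pade approximants at 1, and the remaining
   polynomial inequalities hold because Bernstein coefficients are nonnegative. *)

(** * Bounds on the logarithm *)

Lemma is_derive_ge0_le (R : realType) (f df : R -> R) (a b : R) :
  a <= b -> (forall t, a <= t <= b -> is_derive t 1 f (df t)) ->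
  (forall t, a <= t <= b -> 0 <= df t) -> f a <= f b.
Proof.
move=> ab hd hge.
have hc : {within `[a, b], continuous f}.
  apply: derivable_within_continuous => t; rewrite in_itv /= => /hd ht.
  exact: ex_derive.
have [|c] := MVT_segment ab _ hc (df := df).
  by move=> t; rewrite in_itv /= => /andP[/ltW at_ /ltW tb]; apply: hd; rewrite at_.
rewrite in_itv /= => hcab e.
by rewrite -subr_ge0 e mulr_ge0 ?hge // subr_ge0.
Qed.

Lemma is_derive_add_scale (R : realType) (f g : R -> R) (c t df dg : R) :
  is_derive t 1 f df -> is_derive t 1 g dg ->
  is_derive t 1 (fun u => f u + c * g u) (df + c * dg).
Proof. by move=> hf hg; exact: (is_deriveD hf (is_deriveZ c hg)). Qed.

Lemma is_derive_affine (R : realType) (p q t : R) :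
  is_derive t 1 (fun u : R => p + q * u) q.
Proof.
have -> : (fun u : R => p + q * u) = cst p + q \*: (id : R -> R) by [].
by apply: is_derive_eq; rewrite add0r; rewrite /GRing.scale /= mulr1.
Qed.

Lemma is_derive_inv_affine (R : realType) (p q t : R) : p + q * t != 0 ->
  is_derive t 1 (fun u : R => (p + q * u)^-1) (- (p + q * t) ^- 2 * q).
Proof.
move=> h0; have [df dfE] := is_derive_affine p q t; split; first exact: derivableV.
by rewrite (@deriveV _ _ (fun u : R => p + q * u)) // dfE.
Qed.

Lemma is_derive_ln_affine (R : realType) (p q t : R) : 0 < p + q * t ->
  is_derive t 1 (fun u : R => ln (p + q * u)) (q / (p + q * t)).
Proof.
move=> h0; have hl := is_derive1_ln h0.
have := @is_derive1_comp _ (@ln R) (fun u : R => p + q * u) t _ _ hl (is_derive_affine p q t).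
by rewrite mulrC.
Qed.

(** The difference of the two sides vanishes at 1 and has derivative [(t - 1)^2 / (t (1 + t)^2)].
    Since [2 (t - 1) / (t + 1) = 2 - 4 / (t + 1)], the function [f] below is that difference up to a
    constant. *)
Lemma ln_ge_pade (R : realType) (z : R) : 1 <= z -> 2 * (z - 1) / (z + 1) <= ln z.
Proof.
move=> z1.
pose f (t : R) := ln (0 + 1 * t) + 4 * (1 + 1 * t)^-1.
have h : f 1 <= f z.
  apply: (@is_derive_ge0_le _ f (fun t => 1 / (0 + 1 * t) + 4 * (- (1 + 1 * t) ^- 2 * 1)))
    => [|t /andP[t1 _]|t /andP[t1 _]]; first exact: z1.
    have h0 : 0 < 0 + 1 * t by lra.
    have h1 : 1 + 1 * t != 0 by lra.
    have d1 := is_derive_ln_affine h0.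
    have d2 := is_derive_inv_affine h1.
    exact: (is_derive_add_scale _ d1 d2).
  have -> : 1 / (0 + 1 * t) + 4 * (- (1 + 1 * t) ^- 2 * 1) = (t - 1) ^+ 2 / (t * (1 + t) ^+ 2).
    by field; apply/andP; split; apply: lt0r_neq0; lra.
  by rewrite divr_ge0 ?sqr_ge0 // mulr_ge0 ?sqr_ge0 //; lra.
move: h; rewrite /f !mulr1 !mul1r !add0r ln1 => h.
have -> : 2 * (z - 1) / (z + 1) = 4 / (1 + 1) - 4 / (1 + z).
  by field; apply: lt0r_neq0; lra.
lra.
Qed.

(** This approximant agrees with [ln] to third order at 1: the derivative of the difference is
    [4 (t - 1)^3 / (t (2 + 4 t)^2)]. *)
Lemma ln_le_pade (R : realType) (z : R) : 1 <= z ->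
  ln z <= (z - 1) * (z + 5) / (4 * z + 2).
Proof.
move=> z1.
(* [(z - 1) (z + 5) / (4 z + 2) = z / 4 + 7 / 8 - (27 / 4) / (4 z + 2)] *)
pose f (t : R) := (7 / 8 + 1 / 4 * t) + (-1) * ln (0 + 1 * t) + (- (27 / 4)) * (2 + 4 * t)^-1.
have h : f 1 <= f z.
  apply: (@is_derive_ge0_le _ f
    (fun t => 1 / 4 + (-1) * (1 / (0 + 1 * t)) + (- (27 / 4)) * (- (2 + 4 * t) ^- 2 * 4)))
    => [|t /andP[t1 _]|t /andP[t1 _]]; first exact: z1.
    have h0 : 0 < 0 + 1 * t by lra.
    have h1 : 2 + 4 * t != 0 by lra.
    have d1 := is_derive_ln_affine h0.
    have d2 := is_derive_inv_affine h1.
    exact: (is_derive_add_scale _ (is_derive_add_scale _ (is_derive_affine _ _ t) d1) d2).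
  have -> : 1 / 4 + (-1) * (1 / (0 + 1 * t)) + (- (27 / 4)) * (- (2 + 4 * t) ^- 2 * 4) =
      4 * (t - 1) ^+ 3 / (t * (2 + 4 * t) ^+ 2).
    by field; apply/andP; split; apply: lt0r_neq0; lra.
  by rewrite divr_ge0 ?mulr_ge0 ?sqr_ge0 ?exprn_ge0 //; lra.
move: h; rewrite /f !mulr1 !mul1r !add0r ln1 => h.
have -> : (z - 1) * (z + 5) / (4 * z + 2) =
    27 / 4 / (2 + 4) + 1 / 4 * (z - 1) - 27 / 4 / (2 + 4 * z).
  by field; apply: lt0r_neq0; lra.
lra.
Qed.

(** * The two-variable inequality *)

(* Numerator of [join_gap x (t * x) / x] below, once the logarithms in it are
   replaced by their Pade bounds. *)
Definition join_poly (R : realFieldType) (x t : R) :=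
  let y := t * x in let z := 1 + t - t * x in let s := x * z in
  let w := 1 + t - 2 * t * x in
  - w * (z - 1) * (z + 5) * (4 + 2 * t) * (1 + s) * z
  - (1 - x) * (1 - t) * (1 + 5 * t) * (4 * z + 2) * (1 + s) * z
  + 2 * t * x * (1 - x) * (1 - y) * (4 * z + 2) * (4 + 2 * t) * z
  + 69 / 100 * t * x * w * (4 * z + 2) * (4 + 2 * t) * (1 + s)
  + (w * (4 / 100) + 3 / 10 * (1 - x) * (3 - 2 * x) * (1 - 2 * y)
     + 3 / 10 * t * (1 - y) * (3 - 2 * y) * (1 - 2 * x))
    * (4 * z + 2) * (4 + 2 * t) * (1 + s) * z.

Ltac bernstein_row7 H i i' :=
  move: (H i i' 0 7)%N (H i i' 1 6)%N (H i i' 2 5)%N (H i i' 3 4)%N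
        (H i i' 4 3)%N (H i i' 5 2)%N (H i i' 6 1)%N (H i i' 7 0)%N.
(** [lra] treats the monomials in [x] and [t] as independent atoms, so once the 64 products are
    premises, it finds the Bernstein coefficients by linear algebra. *)
Ltac bernstein7x7 H :=
  bernstein_row7 H 0%N 7%N; bernstein_row7 H 1%N 6%N; bernstein_row7 H 2%N 5%N;
  bernstein_row7 H 3%N 4%N; bernstein_row7 H 4%N 3%N; bernstein_row7 H 5%N 2%N;
  bernstein_row7 H 6%N 1%N; bernstein_row7 H 7%N 0%N;
  clear H; rewrite /join_poly /=; lra.

(* [join_poly] has degree 7 in each variable, and on [[a, b] x [0, 1]] for the
   three intervals [[a, b]] used below its 64 Bernstein coefficients are
   nonnegative: it is a nonnegative combination of the products [B]. *)
Lemma join_poly_ge0 (R : realFieldType) (x t : R) :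
  0 <= x <= 1 -> 0 <= t <= 1 -> 0 <= join_poly x t.
Proof.
move=> /andP[x0 x1] /andP[t0 t1].
have B (u v : R) (i i' j j' : nat) : 0 <= u -> 0 <= v ->
    0 <= (u ^+ i * v ^+ i') * (t ^+ j * (1 - t) ^+ j').
  by move=> u0 v0; rewrite !mulr_ge0 ?exprn_ge0 ?subr_ge0.
have [h1|/ltW h1] := leP x (1 / 2).
  have v0 : 0 <= 1 - 2 * x by lra.
  have H i i' j j' := B _ _ i i' j j' x0 v0; clear B x0 x1 t0 t1 h1 v0; bernstein7x7 H.
have u0 : 0 <= 2 * x - 1 by lra.
have [h2|/ltW h2] := leP x (7 / 10).
  have v0 : 0 <= 7 - 10 * x by lra.
  have H i i' j j' := B _ _ i i' j j' u0 v0; clear B x0 x1 t0 t1 h1 h2 u0 v0; bernstein7x7 H.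
have u1 : 0 <= 10 * x - 7 by lra.
have v0 : 0 <= 1 - x by lra.
have H i i' j j' := B _ _ i i' j j' u1 v0; clear B x0 x1 t0 t1 h1 h2 u0 u1 v0; bernstein7x7 H.
Qed.

(* [1 - 2 * y] has nonnegative mean, so adding [slack x * (1 - 2 * y)] costs nothing
   as long as [2 * slack <= entropy]; it is what makes [join_gap] nonnegative
   when [x] and [y] are both small. *)
Definition slack (R : realFieldType) (x : R) := 3 / 10 * x * (1 - x) * (3 - 2 * x).

(** Since [1 - s = (1 - x) (1 - y)], the logarithmic terms are [H(s) - (1 - y) H(x) - (1 - x) H(y)]
    with [H] the entropy. The [69 / 100] term is the gain of [deficit_chord]; the [4 / 100] term is
    paid for by the margin in [deficit1_gap]. *)
Definition join_gap (R : realType) (x y : R) :=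
  let s := x + y - x * y in
  x * (1 - y) * ln x + y * (1 - x) * ln y - s * ln s
  + 69 / 100 * (x * y * (x + y - 2 * (x * y)) / s)
  + 4 / 100 * (x + y - 2 * (x * y))
  + slack x * (1 - 2 * y) + slack y * (1 - 2 * x).

Lemma join_gapC (R : realType) (x y : R) : join_gap x y = join_gap y x.
Proof. by rewrite /join_gap (mulrC y x) (addrC y x); ring. Qed.

(** With [y = t x] and [s = x z], a factor [x] comes out and [ln x] survives only inside [- ln s].
    The bounds [z >= 1], [t <= 1] and [s <= 1] allow the Pade estimates to be used at [z], [1 / t]
    and [1 / s]; the pole of the second at [t = 0] is cancelled by the weight [t (1 - x)]. *)
Lemma join_gap_ge0_wlog (R : realType) (x y : R) :
  0 < x -> x <= 1 -> 0 < y -> y <= x -> 0 <= join_gap x y.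
Proof.
move=> x0 x1 y0 yx.
pose t := y / x; have yE : y = t * x by rewrite /t mulfVK ?gt_eqF.
have t0 : 0 < t by rewrite divr_gt0.
have t1 : t <= 1 by rewrite ler_pdivrMr ?mul1r.
pose z := 1 + t - t * x; pose s := x * z.
have z1 : 1 <= z by rewrite /z -addrA lerDl subr_ge0 ler_piMr // ltW.
have z0 : 0 < z by lra.
have s0 : 0 < s by rewrite mulr_gt0.
have ty1 : t * x <= 1 by rewrite mulr_ile1 // ltW.
have sE : 1 - s = (1 - x) * (1 - t * x) by rewrite /s /z; ring.
have s1 : s <= 1 by rewrite -subr_ge0 sE mulr_ge0 // subr_ge0.
have lnz := ln_le_pade z1.
have lnt : - ln t <= (1 - t) * (1 + 5 * t) / (t * (4 + 2 * t)).
  rewrite -lnV //; have := @ln_le_pade _ t^-1; rewrite invf_ge1 // => /(_ t1).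
  congr (_ <= _); field; do ?[apply/andP; split]; apply: lt0r_neq0; nra.
have lns : 2 * (1 - s) / (1 + s) <= - ln s.
  rewrite -lnV //; have := @ln_ge_pade _ s^-1; rewrite invf_ge1 // => /(_ s1).
  congr (_ <= _); field; do ?[apply/andP; split]; apply: lt0r_neq0; lra.
have -> : join_gap x y =
    x * (t * (1 - x) * ln t + (1 + t - 2 * t * x) * (- ln z) + t * x * (- ln s)
     + 69 / 100 * (t * x * (1 + t - 2 * t * x) / z)
     + 4 / 100 * (1 + t - 2 * t * x)
     + 3 / 10 * (1 - x) * (3 - 2 * x) * (1 - 2 * (t * x))
     + 3 / 10 * t * (1 - t * x) * (3 - 2 * (t * x)) * (1 - 2 * x)).
  have lnyE : ln y = ln t + ln x by rewrite yE lnM.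
  have lnsE : ln s = ln x + ln z by rewrite /s lnM.
  have -> : join_gap x y = x * (1 - y) * ln x + y * (1 - x) * ln y - s * ln s
     + 69 / 100 * (x * y * (x + y - 2 * (x * y)) / s)
     + 4 / 100 * (x + y - 2 * (x * y))
     + slack x * (1 - 2 * y) + slack y * (1 - 2 * x).
    by rewrite /join_gap; have -> : x + y - x * y = s by rewrite /s /z yE; ring.
  have -> : x * y * (x + y - 2 * (x * y)) / s = x * (t * x * (1 + t - 2 * t * x) / z).
    by rewrite /s yE; field; rewrite !gt_eqF.
  rewrite lnyE lnsE /slack yE /s /z; ring.
apply: mulr_ge0; first exact: ltW.
have w0 : 0 <= 1 + t - 2 * t * x by nra.
have ht : - ((1 - x) * ((1 - t) * (1 + 5 * t) / (4 + 2 * t))) <= t * (1 - x) * ln t.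
  have c0 : 0 <= t * (1 - x) by rewrite mulr_ge0 ?subr_ge0 // ltW.
  have := ler_wpM2l c0 lnt.
  have -> : t * (1 - x) * ((1 - t) * (1 + 5 * t) / (t * (4 + 2 * t)))
    = (1 - x) * ((1 - t) * (1 + 5 * t) / (4 + 2 * t)).
    by field; do ?[apply/andP; split]; apply: lt0r_neq0; lra.
  lra.
have hz : (1 + t - 2 * t * x) * - ((z - 1) * (z + 5) / (4 * z + 2))
    <= (1 + t - 2 * t * x) * (- ln z) by rewrite ler_wpM2l // lerN2.
have hs : t * x * (2 * (1 - s) / (1 + s)) <= t * x * (- ln s).
  by rewrite ler_wpM2l // mulr_ge0 // ltW.
have x01 : 0 <= x <= 1 by rewrite ltW.
have t01 : 0 <= t <= 1 by rewrite ltW.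
have d0 : 0 < (4 * z + 2) * (4 + 2 * t) * (1 + s) * z by rewrite !mulr_gt0 //; lra.
have := divr_ge0 (join_poly_ge0 x01 t01) (ltW d0).
have -> : join_poly x t / ((4 * z + 2) * (4 + 2 * t) * (1 + s) * z) =
    - ((1 - x) * ((1 - t) * (1 + 5 * t) / (4 + 2 * t)))
    + (1 + t - 2 * t * x) * - ((z - 1) * (z + 5) / (4 * z + 2))
    + t * x * (2 * (1 - s) / (1 + s))
     + 69 / 100 * (t * x * (1 + t - 2 * t * x) / z)
     + 4 / 100 * (1 + t - 2 * t * x)
     + 3 / 10 * (1 - x) * (3 - 2 * x) * (1 - 2 * (t * x))
     + 3 / 10 * t * (1 - t * x) * (3 - 2 * (t * x)) * (1 - 2 * x).
  rewrite sE /join_poly -/z -/s; field.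
  by rewrite !gt_eqF //=; lra.
lra.
Qed.

Lemma join_gap_ge0 (R : realType) (x y : R) :
  0 <= x <= 1 -> 0 <= y <= 1 -> 0 <= join_gap x y.
Proof.
(* On the axis the logarithms cancel, and only [4 / 100 * u + slack u] is left. *)
have ax (u : R) : 0 <= u <= 1 -> 0 <= join_gap u 0.
  move=> /andP[u0 u1]; rewrite /join_gap /slack !(mulr0, mul0r, addr0, subr0, mulr1).
  rewrite subrr !add0r addr_ge0 ?mulr_ge0 //; lra.
move=> x01 y01; case/andP: (x01) (y01) => x0 x1 /andP[y0 y1].
have [->|xn0] := eqVneq x 0; first by rewrite join_gapC ax.
have [->|yn0] := eqVneq y 0; first exact: ax.
have [yx|/ltW xy] := leP y x.
  by apply: join_gap_ge0_wlog; rewrite // lt0r ?xn0 ?yn0.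
by rewrite join_gapC; apply: join_gap_ge0_wlog; rewrite // lt0r ?xn0 ?yn0.
Qed.

(** * The deficit from uniformity *)

Lemma is_derive_xlogx_affine (R : realType) (p q t : R) : 0 < p + q * t ->
  is_derive t 1 (fun u : R => xlogx (p + q * u)) (q * (ln (p + q * t) + 1)).
Proof.
move=> h0; have n0 := lt0r_neq0 h0.
have h := is_deriveM (is_derive_affine p q t) (is_derive_ln_affine h0).
apply: (is_derive_eq h).
by rewrite /GRing.scale /=; field.
Qed.

Lemma ln_le_rat (R : realType) (z : R) : 0 < z -> z <= 1 ->
  ln z <= 2 * (z - 1) / (z + 1).
Proof.
move=> z0 z1; have := @ln_ge_pade _ z^-1; rewrite invf_ge1 // lnV // => /(_ z1).
have -> : 2 * (z^-1 - 1) / (z^-1 + 1) = - (2 * (z - 1) / (z + 1)).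
  by field; do ?[apply/andP; split]; apply: lt0r_neq0; lra.
lra.
Qed.

(* [xlogx (1 + b)] has second derivative [1 / (1 + b)], whose average over the
   triangle of the second divided difference at [0, r b, b] is at least its
   value at the barycenter [(1 + r) b / 3]. *)
Lemma xlogx_chord (R : realType) (r b : R) : 0 <= r <= 1 -> -1 <= b ->
  r * (1 - r) * (3 / 2 * b ^+ 2 / (3 + (1 + r) * b)) <=
  r * xlogx (1 + b) - xlogx (1 + r * b).
Proof.
move=> /andP[r0 r1] b1.
have [->|rn1] := eqVneq r 1; first by rewrite !(mul1r, subrr, mulr0, mul0r).
have {rn1 r1} r1 : r < 1 by rewrite lt_neqAle rn1.
(* At [b = -1] the derivative used below does not exist; there [xlogx 0 = 0] and a bound on
   [ln (1 - r)] suffices. *)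
have [->|bn1] := eqVneq b (-1).
  rewrite /xlogx subrr mul0r mulr0 add0r (mulrN1 r).
  have h0 : 0 < 1 - r by lra.
  have h1 : 1 - r <= 1 by lra.
  have := ler_wpM2l (ltW h0) (ln_le_rat h0 h1).
  have : 0 <= r * (1 - r) / (2 * (2 - r)) by rewrite divr_ge0 ?mulr_ge0 //; lra.
  have -> : r * (1 - r) * (3 / 2 * (-1) ^+ 2 / (3 + (1 + r) * -1)) =
     3 * r * (1 - r) / (2 * (2 - r)) by field; do ?[apply/andP; split]; apply: lt0r_neq0; lra.
  have -> : (1 - r) * (2 * (1 - r - 1) / (1 - r + 1)) = - (4 * r * (1 - r) / (2 * (2 - r))).
    by field; do ?[apply/andP; split]; apply: lt0r_neq0; lra.
  have -> : 4 * r * (1 - r) / (2 * (2 - r)) = 3 * r * (1 - r) / (2 * (2 - r)) +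
     r * (1 - r) / (2 * (2 - r)) by field; do ?[apply/andP; split]; apply: lt0r_neq0; lra.
  lra.
have {bn1 b1} b1 : -1 < b by rewrite lt_neqAle eq_sym bn1.
pose c := 1 + r; have c0 : 0 < c by rewrite /c; lra.
pose q := 3 / 2 * (r * (1 - r)).
(* [t^2 / (3 + c t) = t / c - 3 / c^2 + (9 / c^2) / (3 + c t)] *)
pose f (t : R) := (q * 3 / c ^+ 2 + (- q / c) * t) + r * xlogx (1 + 1 * t)
  + (-1) * xlogx (1 + r * t) + (- (q * 9 / c ^+ 2)) * (3 + c * t)^-1.
pose df (t : R) := (- q / c) + r * (1 * (ln (1 + 1 * t) + 1))
  + (-1) * (r * (ln (1 + r * t) + 1)) + (- (q * 9 / c ^+ 2)) * (- (3 + c * t) ^- 2 * c).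
have pos1 (t : R) : -1 < t -> 0 < 1 + 1 * t by move=> ?; lra.
have posr (t : R) : -1 < t -> 0 < 1 + r * t by move=> ?; nra.
have posc (t : R) : -1 < t -> 0 < 3 + c * t by move=> ?; rewrite /c; nra.
have fE (t : R) : -1 < t -> f t = r * xlogx (1 + t) - xlogx (1 + r * t)
    - r * (1 - r) * (3 / 2 * t ^+ 2 / (3 + c * t)).
  move=> t1; rewrite /f /q mul1r; field.
  by do ?[apply/andP; split]; apply: lt0r_neq0; rewrite ?posc.
have dfE (t : R) : -1 < t -> df t = r * (ln ((1 + t) / (1 + r * t))
    - 3 / 2 * (1 - r) * (6 * t + c * t ^+ 2) / (3 + c * t) ^+ 2).
  move=> t1; rewrite ln_div ?posrE ?posr //; last by have := pos1 _ t1; rewrite mul1r.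
  rewrite /df /q !mul1r; field.
  by do ?[apply/andP; split]; apply: lt0r_neq0; rewrite ?posc.
have derf (t : R) : -1 < t -> is_derive t 1 f (df t).
  move=> t1; have h1 := pos1 _ t1; have h2 := posr _ t1.
  have h3 := lt0r_neq0 (posc _ t1).
  have d1 := is_derive_xlogx_affine h1; have d2 := is_derive_xlogx_affine h2.
  have d3 := is_derive_inv_affine h3.
  have d0 := is_derive_affine (q * 3 / c ^+ 2) (- q / c) t.
  exact: (is_derive_add_scale _ (is_derive_add_scale _ (is_derive_add_scale _ d0 d1) d2) d3).
have f0 : f 0 = 0 by rewrite fE // mulr0 !addr0 /xlogx ln1 expr0n /= !(mulr0, mul0r) !subr0.
suff : 0 <= f b by rewrite fE // subr_ge0.
have gap (t : R) : -1 < t -> (1 + t) / (1 + r * t) - 1 = t * (1 - r) / (1 + r * t).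
  by move=> t1; field; apply: lt0r_neq0; exact: posr.
(* The Pade bound for [ln] at [(1 + t) / (1 + r t)] differs from the rational part of [df] by a term
   with the sign of [t]. Hence [f] decreases up to 0 and increases after it, and [f 0 = 0]. *)
have pade (t : R) : -1 < t -> 2 * ((1 + t) / (1 + r * t) - 1) / ((1 + t) / (1 + r * t) + 1) =
    3 / 2 * (1 - r) * (6 * t + c * t ^+ 2) / (3 + c * t) ^+ 2
    + (1 - r) * t * (c * t) ^+ 2 / (2 * (2 + c * t) * (3 + c * t) ^+ 2).
  move=> t1; rewrite /c; field.
  by do ?[apply/andP; split]; apply: lt0r_neq0; have := posc _ t1; have := posr _ t1;
    rewrite /c; nra.
have rest (t : R) : -1 < t -> 0 <= (1 - r) * (c * t) ^+ 2 / (2 * (2 + c * t) * (3 + c * t) ^+ 2).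
  move=> t1; have p2 : 0 <= 2 + c * t by rewrite /c; nra.
  by apply: divr_ge0; apply: mulr_ge0; rewrite ?sqr_ge0 // ?mulr_ge0 // subr_ge0 ltW.
have restE (t : R) : (1 - r) * t * (c * t) ^+ 2 / (2 * (2 + c * t) * (3 + c * t) ^+ 2) =
    t * ((1 - r) * (c * t) ^+ 2 / (2 * (2 + c * t) * (3 + c * t) ^+ 2)) by ring.
have [b0|b0] := leP 0 b.
  rewrite -f0; apply: (@is_derive_ge0_le _ f df).
  - exact: b0.
  - by move=> t /andP[t0 _]; apply: derf; lra.
  move=> t /andP[t0 _]; have t1 : -1 < t by lra.
  have z1 : 1 <= (1 + t) / (1 + r * t) by
    rewrite -subr_ge0 gap // divr_ge0 ?(ltW (posr _ t1)) // mulr_ge0 //; lra.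
  have := ln_ge_pade z1; rewrite pade // restE => h.
  rewrite dfE // mulr_ge0 // subr_ge0 (le_trans _ h) // lerDl mulr_ge0 ?rest //.
rewrite -oppr_le0 -oppr0 -f0.
apply: (@is_derive_ge0_le _ (- f) (fun t => - df t)).
- exact: ltW.
- by move=> t /andP[t0 _]; apply: is_deriveN; apply: derf; lra.
move=> t /andP[t0 t0']; have t1 : -1 < t by lra.
have z0 : 0 < (1 + t) / (1 + r * t) by rewrite divr_gt0 ?posr //; lra.
have z1 : (1 + t) / (1 + r * t) <= 1.
  by rewrite -subr_le0 gap // pmulr_lle0 ?invr_gt0 ?posr // pmulr_lle0 //; lra.
have := ln_le_rat z0 z1; rewrite pade // restE => h.
rewrite dfE // oppr_ge0 mulr_ge0_le0 // subr_le0 (le_trans h) // gerDl.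
by rewrite mulr_le0_ge0 ?rest.
Qed.

Lemma sum_sqr_sub (R : realFieldType) (a : R) (n : nat) :
  \sum_(1 <= j < n.+1) (a - j%:R) ^+ 2 =
  n%:R * a ^+ 2 - a * n%:R * (n%:R + 1) + n%:R * (n%:R + 1) * (2 * n%:R + 1) / 6.
Proof.
elim: n => [|n IH]; first by rewrite big_nil; ring.
by rewrite big_nat_recr //= IH -!natr1; field.
Qed.

Lemma sum_cube_sub (R : realFieldType) (a : R) (n : nat) :
  \sum_(1 <= j < n.+1) (a - j%:R) ^+ 3 =
  n%:R * a ^+ 3 - 3 / 2 * a ^+ 2 * n%:R * (n%:R + 1)
  + a * n%:R * (n%:R + 1) * (2 * n%:R + 1) / 2 - (n%:R * (n%:R + 1)) ^+ 2 / 4.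
Proof.
elim: n => [|n IH]; first by rewrite big_nil; ring.
by rewrite big_nat_recr //= IH -!natr1; field.
Qed.

(* Writing [s = x + y - x y] and [r = x y / s], the nonzero outcomes of the
   entropy [g_km k m (x / k) (y / k)] have probabilities [s / k * (1 + r * b)]
   with [b = top_dev k] for the middle term and [b = - low_dev k j] for the others. *)
Definition top_dev (R : realFieldType) (k : nat) : R := (k%:R + 1) / 2 - k%:R^-1.

Definition low_dev (R : realFieldType) (k j : nat) : R := (k%:R + 1 - j%:R) / k%:R.

Definition deficit (R : realType) (k : nat) (r : R) : R :=
  (xlogx (1 + r * top_dev R k)
   + \sum_(1 <= j < k) xlogx (1 + r * - low_dev R k j)) / k%:R.

Lemma low_dev_bounds (R : realFieldType) (k j : nat) : (1 <= j < k)%N ->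
  0 <= low_dev R k j <= 1.
Proof.
move=> /andP[j1 jk]; have k0 : 0 < k%:R :> R by rewrite ltr0n (leq_ltn_trans _ jk).
have : j%:R <= k%:R :> R by rewrite ler_nat ltnW.
have : 1 <= j%:R :> R by rewrite ler1n.
move=> h1 h2; rewrite /low_dev divr_ge0 ?ler_pdivrMr ?mul1r //=; lra.
Qed.

Ltac bernstein_row6 H i i' :=
  move: (H i i' 0 6)%N (H i i' 1 5)%N (H i i' 2 4)%N (H i i' 3 3)%N
        (H i i' 4 2)%N (H i i' 5 1)%N (H i i' 6 0)%N.
Ltac bernstein3x6 H :=
  bernstein_row6 H 0%N 3%N; bernstein_row6 H 1%N 2%N; bernstein_row6 H 2%N 1%N;
  bernstein_row6 H 3%N 0%N; clear H; rewrite /=; lra.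

(* [e] stands for [1 / k]; the degrees are 6 and 3, and on each of the three
   strips the Bernstein coefficients are nonnegative. *)
Lemma deficit_poly_ge0 (R : realFieldType) (e r : R) :
  0 <= e <= 1 / 5 -> 0 <= r <= 1 ->
  let c := 1 + r in let a := 3 - 4 / 5 * c in let b := 1 / 2 + e / 2 - e ^+ 2 in
  let s2 := 1 / 3 + e / 2 + e ^+ 2 / 6 - e ^+ 3 in
  let s3 := 1 / 4 + e / 2 + e ^+ 2 / 4 - e ^+ 4 in
  0 <= 3 / 2 * (b ^+ 2 * a ^+ 2 + (3 * e + c * b) * (2 * s2 * a - (3 * s2 - c * s3)))
    - 69 / 100 * (3 * e + c * b) * a ^+ 2.
Proof.
move=> /andP[e0 e5] /andP[r0 r1].
have B (u v : R) (i i' j j' : nat) : 0 <= u -> 0 <= v ->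
    0 <= (u ^+ i * v ^+ i') * (e ^+ j * (1 - 5 * e) ^+ j').
  by move=> u0 v0; rewrite !mulr_ge0 ?exprn_ge0 //; lra.
have [h1|/ltW h1] := leP r (1 / 4).
  have v0 : 0 <= 1 - 4 * r by lra.
  have H i i' j j' := B _ _ i i' j j' r0 v0; clear B e0 e5 r0 r1 h1 v0; bernstein3x6 H.
have [h2|/ltW h2] := leP r (1 / 2).
  have u0 : 0 <= 4 * r - 1 by lra.
  have v0 : 0 <= 1 - 2 * r by lra.
  have H i i' j j' := B _ _ i i' j j' u0 v0; clear B e0 e5 r0 r1 h1 h2 u0 v0; bernstein3x6 H.
have u0 : 0 <= 2 * r - 1 by lra.
have v0 : 0 <= 1 - r by lra.
have H i i' j j' := B _ _ i i' j j' u0 v0; clear B e0 e5 r0 r1 h1 h2 u0 v0; bernstein3x6 H.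
Qed.

(** [xlogx_chord] is summed over the [k] outcomes. For a low outcome with deviation [- u], the
    fraction [1 / (3 - c u)] is first replaced by its tangent, so that only the sums of [u^2] and
    [u^3] occur; these are polynomials in [1 / k], up to a factor [k]. *)
Lemma deficit_chord (R : realType) (k : nat) (r : R) : (5 <= k)%N -> 0 <= r <= 1 ->
  69 / 100 * (r * (1 - r)) <= r * deficit k (1 : R) - deficit k r.
Proof.
move=> k5 r01; have /andP[r0 r1] := r01.
have k5R : 5 <= k%:R :> R by rewrite ler_nat.
have k0 : 0 < k%:R :> R by lra.
have n0 : k%:R != 0 :> R by rewrite gt_eqF.
(* The tangent to [w |-> 1 / w] is taken at [w = a], that is at [u = 4 / 5]. This is close to the
   mean of [low_dev] with weights [low_dev ^+ 2], which is about 0.83 for [k = 5] and tends to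
   3/4. *)
pose c := 1 + r; pose a := 3 - 4 / 5 * c.
have c0 : 0 < c by rewrite /c; lra.
have a0 : 0 < a by rewrite /a /c; lra.
have top0 : 0 < top_dev R k.
  have : k%:R^-1 <= 1 :> R by rewrite invf_le1 //; lra.
  by rewrite /top_dev; lra.
have htop := @xlogx_chord _ r (top_dev R k) r01 _.
have {}htop := htop (ltW (lt_trans (ltrN10 R) top0)).
have hlow j : (1 <= j < k)%N -> r * (1 - r) * (3 / 2 * (low_dev R k j ^+ 2 * (2 / a - 3 / a ^+ 2)
      + low_dev R k j ^+ 3 * (c / a ^+ 2))) <=
    r * xlogx (1 + 1 * - low_dev R k j) - xlogx (1 + r * - low_dev R k j).
  move=> hj; have /andP[u0 u1] := low_dev_bounds R hj; set u := low_dev R k j in u0 u1 *.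
  have b1 : -1 <= - u by lra.
  have w0 : 0 < 3 - c * u by rewrite /c; nra.
  rewrite mul1r; apply: le_trans (xlogx_chord r01 b1).
  rewrite ler_wpM2l //; first by rewrite mulr_ge0 // subr_ge0.
  rewrite -subr_ge0.
  have -> : 3 / 2 * (- u) ^+ 2 / (3 + (1 + r) * - u) - 3 / 2 *
      (u ^+ 2 * (2 / a - 3 / a ^+ 2) + u ^+ 3 * (c / a ^+ 2)) =
      3 / 2 * u ^+ 2 * (a - (3 - c * u)) ^+ 2 / (a ^+ 2 * (3 - c * u)).
    rewrite -/c; field; do ?[apply/andP; split]; apply: lt0r_neq0 => //; lra.
  have h0 : 0 <= 3 / 2 :> R by lra.
  exact: (divr_ge0 (mulr_ge0 (mulr_ge0 h0 (sqr_ge0 _)) (sqr_ge0 _))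
    (mulr_ge0 (sqr_ge0 _) (ltW w0))).
have S2 : \sum_(1 <= j < k) low_dev R k j ^+ 2 =
    k%:R * (1 / 3 + k%:R^-1 / 2 + k%:R^-1 ^+ 2 / 6 - k%:R^-1 ^+ 3).
  rewrite /low_dev; under eq_bigr do rewrite expr_div_n; rewrite -mulr_suml.
  case: k k5 k5R k0 n0 {top0 htop hlow} => // n _ _ _; rewrite sum_sqr_sub -[n.+1%:R]natr1 => n0.
  by field.
have S3 : \sum_(1 <= j < k) low_dev R k j ^+ 3 =
    k%:R * (1 / 4 + k%:R^-1 / 2 + k%:R^-1 ^+ 2 / 4 - k%:R^-1 ^+ 4).
  rewrite /low_dev; under eq_bigr do rewrite expr_div_n; rewrite -mulr_suml.
  case: k k5 k5R k0 n0 {top0 htop hlow S2} => // n _ _ _;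
  rewrite sum_cube_sub -[n.+1%:R]natr1 => n0.
  by field.
have {hlow} : r * (1 - r) *
    (3 / 2 * (k%:R * (1 / 3 + k%:R^-1 / 2 + k%:R^-1 ^+ 2 / 6 - k%:R^-1 ^+ 3) * (2 / a - 3 / a ^+ 2)
     + k%:R * (1 / 4 + k%:R^-1 / 2 + k%:R^-1 ^+ 2 / 4 - k%:R^-1 ^+ 4) * (c / a ^+ 2))) <=
    r * (\sum_(1 <= j < k) xlogx (1 + 1 * - low_dev R k j)) -
    \sum_(1 <= j < k) xlogx (1 + r * - low_dev R k j).
  rewrite -S2 -S3 !mulr_suml -big_split /= mulr_sumr mulr_sumr mulr_sumr -sumrB.
  by rewrite big_nat [leRHS]big_nat; apply: ler_sum => j /hlow.
rewrite /deficit; set X := \sum_(_ <= _ < _) _; set Y := \sum_(_ <= _ < _) _ => hlow.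
rewrite mul1r.
have -> : r * ((xlogx (1 + top_dev R k) + X) / k%:R) - (xlogx (1 + r * top_dev R k) + Y) / k%:R =
  ((r * xlogx (1 + top_dev R k) - xlogx (1 + r * top_dev R k)) + (r * X - Y)) / k%:R.
  by field.
rewrite ler_pdivlMr //; apply: le_trans (lerD htop hlow).
rewrite -mulrDr [leLHS](_ : _ = r * (1 - r) * (69 / 100 * k%:R)); last by ring.
rewrite ler_wpM2l //; first by rewrite mulr_ge0 // subr_ge0.
(* In terms of [e] one has [top_dev = b / e], and clearing denominators gives the polynomial of
   [deficit_poly_ge0]. *)
pose e : R := k%:R^-1.
have e0 : 0 < e by rewrite invr_gt0.
have e01 : 0 <= e <= 1 / 5 by rewrite ltW //= /e -div1r ler_pdivrMr //; lra.
pose b := 1 / 2 + e / 2 - e ^+ 2.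
have b0 : 0 < b by rewrite /b; case/andP: e01; nra.
have d0 : 0 < e * (3 * e + c * b) * a ^+ 2.
  by rewrite !mulr_gt0 ?exprn_gt0 // addr_gt0 ?mulr_gt0.
have := divr_ge0 (deficit_poly_ge0 e01 r01) (ltW d0).
rewrite -subr_ge0 /= -/c -/a -/b; congr (0 <= _).
have kE : k%:R = e^-1 by rewrite /e invrK.
rewrite /top_dev kE invrK.
have -> : (e^-1 + 1) / 2 - e = b / e by rewrite /b; field; rewrite gt_eqF.
field; do ?[apply/andP; split]; apply: lt0r_neq0 => //.
  by rewrite addr_gt0 ?mulr_gt0.
Qed.

(** * The deficit at [r = 1] and its distance to [ln (k / m)] *)

Lemma ln_le_tangent (R : realType) (z a : R) : 0 < z -> 0 < a ->
  ln z <= ln a + (z / a - 1).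
Proof.
move=> z0 a0; have za : 0 < z / a by rewrite divr_gt0.
have h : -1 < z / a - 1 by lra.
have := le_ln1Dx h; have -> : 1 + (z / a - 1) = z / a by ring.
by rewrite ln_div //; lra.
Qed.

(** At [r = 1], the low outcomes have conditional probabilities [(j - 1) / k^2] given a nonzero
    outcome; this is their sum over [1 <= j < k]. *)
Definition low_mass (R : realFieldType) (k : nat) : R :=
  (1 - k%:R^-1) * (1 - 2 * k%:R^-1) / 2.

(* Jensen: the tangent to [ln] at the weighted mean of the points [(j - 1) / k]. *)
Lemma deficit1_le (R : realType) (k : nat) : (5 <= k)%N ->
  deficit k (1 : R) <= low_mass R k * ln (2 / 3 - k%:R^-1)
    + (1 - low_mass R k) * ln (k%:R * (1 - low_mass R k)).
Proof.
move=> k5; rewrite /low_mass; set e : R := k%:R^-1; set w := _ / 2.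
have k5R : 5 <= k%:R :> R by rewrite ler_nat.
have k0 : 0 < k%:R :> R by lra.
have kE : k%:R = e^-1 by rewrite /e invrK.
have e0 : 0 < e by rewrite invr_gt0.
have e5 : e <= 1 / 5 by rewrite /e -div1r ler_pdivrMr //; lra.
(* The points [(j - 1) / k], weighted by themselves, have mean [(2 k - 3) / (3 k)], which is [a]. *)
set a := 2 / 3 - e; have a0 : 0 < a by rewrite /a; lra.
have hj j : (1 <= j < k)%N -> xlogx (1 + 1 * - low_dev R k j) <=
    (ln a - 1) * (1 - low_dev R k j) + a^-1 * (1 - low_dev R k j) ^+ 2.
  move=> hj; have /andP[u0 u1] := low_dev_bounds R hj; set u := low_dev R k j in u0 u1 *.
  rewrite mul1r /xlogx; have [->|un1] := eqVneq u 1.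
    by rewrite subrr !(mul0r, mulr0, expr0n) addr0.
  have v0 : 0 < 1 - u by rewrite subr_gt0 lt_neqAle un1.
  have := ler_wpM2l (ltW v0) (ln_le_tangent v0 a0); lra.
have S1 : \sum_(1 <= j < k) (1 - low_dev R k j) = k%:R * w.
  have -> : \sum_(1 <= j < k) (1 - low_dev R k j) = (\sum_(1 <= j < k) (j%:R - 1)) / k%:R.
    by rewrite mulr_suml; apply: eq_bigr => j _; rewrite /low_dev; field; rewrite gt_eqF.
  have H n : \sum_(1 <= j < n.+1) (j%:R - 1) = n%:R * (n%:R - 1) / 2 :> R.
    elim: n => [|n IH]; first by rewrite big_nil; ring.
    by rewrite big_nat_recr //= IH -!natr1; field.
  rewrite /w /e; case: k k5 {e w a hj kE e0 e5 a0} k5R k0 => // n _ _.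
  rewrite H -[n.+1%:R]natr1 => n0.
  by field; rewrite gt_eqF.
have S2 : \sum_(1 <= j < k) (1 - low_dev R k j) ^+ 2 = a * (k%:R * w).
  have -> : \sum_(1 <= j < k) (1 - low_dev R k j) ^+ 2 =
      (\sum_(1 <= j < k) (1 - j%:R) ^+ 2) / k%:R ^+ 2.
    by rewrite mulr_suml; apply: eq_bigr => j _; rewrite /low_dev; field; rewrite gt_eqF.
  rewrite /a /w /e; case: k k5 {e w a hj kE e0 e5 a0 S1} k5R k0 => // n _ _.
  rewrite sum_sqr_sub -[n.+1%:R]natr1 => n0.
  by field; rewrite gt_eqF.
have : \sum_(1 <= j < k) xlogx (1 + 1 * - low_dev R k j) <= ln a * (k%:R * w).
  apply: (@le_trans _ _ (\sum_(1 <= j < k)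
      ((ln a - 1) * (1 - low_dev R k j) + a^-1 * (1 - low_dev R k j) ^+ 2))).
    by rewrite big_nat [leRHS]big_nat; apply: ler_sum => j /hj.
  rewrite big_split /= -!mulr_sumr S1 S2 mulKf ?gt_eqF //; lra.
rewrite /deficit ler_pdivrMr // => h.
have topE : 1 + 1 * top_dev R k = k%:R * (1 - w).
  by rewrite /top_dev /w /e; field; rewrite gt_eqF.
rewrite topE /xlogx; lra.
Qed.

(** At [9 / 7] the Pade lower bound is exactly [1 / 4]. *)
Lemma two_le_ln_pow (R : realType) : 2 <= 8 * ln (9 / 7 : R).
Proof.
have h : 1 <= 9 / 7 :> R by lra.
have := ln_ge_pade h.
have -> : 2 * (9 / 7 - 1) / (9 / 7 + 1) = 1 / 4 :> R by field.
lra.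
Qed.

(** Since [n / 4 <= ln ((9 / 7) ^+ n)], a numerical bound on logarithms reduces to a comparison of
    rational numbers. *)
Lemma ln_combination_ge (R : realType) (x y z : R) (i j n : nat) :
  0 < x -> 0 < y -> 0 < z -> (9 / 7) ^+ n * (y ^+ i * z ^+ j) <= x ^+ (i + j) ->
  n%:R / 4 <= (i + j)%:R * ln x - i%:R * ln y - j%:R * ln z.
Proof.
move=> x0 y0 z0; have p0 : 0 < 9 / 7 :> R by lra.
rewrite -ler_ln ?posrE ?mulr_gt0 ?exprn_gt0 //.
rewrite !lnM ?posrE ?mulr_gt0 ?exprn_gt0 // !lnXn //.
rewrite -[ln x *+ _]mulr_natl -[ln y *+ _]mulr_natl -[ln z *+ _]mulr_natl.
rewrite -[ln _ *+ n]mulr_natl.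
by have := two_le_ln_pow R; have := ler0n R n; nra.
Qed.

(** The worst case is [m = 2]. For each [k] the integers [i] and [j] are the numerators of
    [low_mass] and [1 - low_mass] over a common denominator [i + j], and [n] satisfies
    [n / (4 (i + j)) >= 8 / 100]. *)
Lemma deficit1_gap_small (R : realType) (k m : nat) : (5 <= k < 9)%N ->
  (1 <= m <= 2)%N -> 8 / 100 <= ln (k%:R : R) - ln m%:R - deficit k (1 : R).
Proof.
move=> /andP[k5 k9] /andP[m1 m2].
have m0 : 0 < m%:R :> R by rewrite ltr0n.
have lnm : ln m%:R <= ln 2 :> R by rewrite ler_ln ?posrE // ler_nat.
have lnE (n : nat) : (0 < n)%N -> ln (n%:R / 2) = ln n%:R - ln 2 :> R.
  by move=> n0; rewrite ln_div ?posrE ?ltr0n.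
have := deficit1_le R k5; rewrite /low_mass.
have [->|->|->|->] : [\/ k = 5, k = 6, k = 7 | k = 8]%N.
  by case: k k5 k9 => [|[|[|[|[|[|[|[|[|]]]]]]]]] // _ _;
    [constructor 1|constructor 2|constructor 3|constructor 4].
- have -> : (1 - 5^-1) * (1 - 2 * 5^-1) / 2 = 6 / 25 :> R by field.
  have -> : 2 / 3 - 5^-1 = 7 / 15 :> R by field.
  have -> : 5 * (1 - 6 / 25) = 19 / 5 :> R by field.
  have := @ln_combination_ge R (5 / 2) (7 / 15) (19 / 5) 6 19 8.
  rewrite (lnE 5%N) // => /(_ ltac:(lra) ltac:(lra) ltac:(lra) ltac:(lra)); lra.
- have -> : (1 - 6^-1) * (1 - 2 * 6^-1) / 2 = 5 / 18 :> R by field.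
  have -> : 2 / 3 - 6^-1 = 1 / 2 :> R by field.
  have -> : 6 * (1 - 5 / 18) = 13 / 3 :> R by field.
  have := @ln_combination_ge R (6 / 2) (1 / 2) (13 / 3) 5 13 6.
  rewrite (lnE 6%N) // => /(_ ltac:(lra) ltac:(lra) ltac:(lra) ltac:(lra)); lra.
- have -> : (1 - 7^-1) * (1 - 2 * 7^-1) / 2 = 15 / 49 :> R by field.
  have -> : 2 / 3 - 7^-1 = 11 / 21 :> R by field.
  have -> : 7 * (1 - 15 / 49) = 34 / 7 :> R by field.
  have := @ln_combination_ge R (7 / 2) (11 / 21) (34 / 7) 15 34 16.
  rewrite (lnE 7%N) // => /(_ ltac:(lra) ltac:(lra) ltac:(lra) ltac:(lra)); lra.
- have -> : (1 - 8^-1) * (1 - 2 * 8^-1) / 2 = 21 / 64 :> R by field.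
  have -> : 2 / 3 - 8^-1 = 13 / 24 :> R by field.
  have -> : 8 * (1 - 21 / 64) = 43 / 8 :> R by field.
  have := @ln_combination_ge R (8 / 2) (13 / 24) (43 / 8) 21 43 21.
  rewrite (lnE 8%N) // => /(_ ltac:(lra) ltac:(lra) ltac:(lra) ltac:(lra)); lra.
Qed.

(* [e] stands for [1 / k] and [w] for the mass of the low outcomes. *)
Lemma deficit1_poly_ge0 (R : realFieldType) (e : R) : 0 <= e <= 1 / 9 ->
  let w := (1 - e) * (1 - 2 * e) / 2 in
  8 / 100 <= - (e * (3 - 2 * e) / 2) * (9 / 7) - (3 - 2 * e) / 18
    + w * (2 / 5 + 3 / 2 * e) + (1 - w) * (w + w ^+ 2 / 2).
Proof.
move=> /andP[e0 e9] /=.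
have B (i j : nat) : 0 <= e ^+ i * (1 - 9 * e) ^+ j.
  by rewrite mulr_ge0 ?exprn_ge0 //; lra.
move: (B 6 0)%N (B 5 1)%N (B 4 2)%N (B 3 3)%N (B 2 4)%N (B 1 5)%N (B 0 6)%N.
lra.
Qed.

(** By [ln m <= ln k / 2] and [deficit1_le], the gap is at least [- (1 / 2 - w) ln k - w ln (2 / 3 -
    e) - (1 - w) ln (1 - w)]. As [1 / 2 - w = e (3 - 2 e) / 2] is of order [1 / k], a bound on
    [ln k] that is linear in [k] is good enough. *)
Lemma deficit1_gap_large (R : realType) (k m : nat) : (9 <= k)%N -> (1 <= m)%N ->
  (m ^ 2 <= k)%N -> 8 / 100 <= ln (k%:R : R) - ln m%:R - deficit k (1 : R).
Proof.
move=> k9 m1 mk.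
have m0 : 0 < m%:R :> R by rewrite ltr0n.
have k9R : 9 <= k%:R :> R by rewrite ler_nat.
have k0 : 0 < k%:R :> R by lra.
have lnm : 2 * ln m%:R <= ln k%:R :> R.
  have : ln (m%:R ^+ 2) <= ln k%:R :> R.
    by rewrite ler_ln ?posrE ?exprn_gt0 // -natrX ler_nat.
  by rewrite lnXn // -[ln _ *+ 2]mulr_natl.
have := deficit1_le R (leq_trans (isT : 5 <= 9)%N k9).
set w := low_mass R k => hD.
pose e : R := k%:R^-1.
have e0 : 0 < e by rewrite invr_gt0.
have e9 : e <= 1 / 9 by rewrite /e -div1r ler_pdivrMr //; lra.
have wE : w = (1 - e) * (1 - 2 * e) / 2 by [].
have w0 : 0 < w by rewrite wE; nra.
have w1 : w <= 1 / 2 by rewrite wE; nra.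
have lnp : w + w ^+ 2 / 2 <= - ln (1 - w).
  have p0 : 0 < 1 - w by lra.
  have p1 : 1 - w <= 1 by lra.
  have := ln_le_rat p0 p1.
  have : w + w ^+ 2 / 2 <= - (2 * (1 - w - 1) / (1 - w + 1)).
    have -> : - (2 * (1 - w - 1) / (1 - w + 1)) = w + w ^+ 2 / 2 + w ^+ 3 / (2 * (2 - w)).
      by field; apply: lt0r_neq0; lra.
    by rewrite lerDl divr_ge0 ?exprn_ge0 ?ltW //; lra.
  lra.
have lna : 2 / 5 + 3 / 2 * e <= - ln (2 / 3 - e).
  have -> : 2 / 3 - e = (1 - 3 / 2 * e) / (3 / 2) by field.
  have q0 : 0 < 1 - 3 / 2 * e by lra.
  have r0 : 0 < 3 / 2 :> R by lra.
  rewrite ln_div ?posrE //.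
  have r1 : 1 <= 3 / 2 :> R by lra.
  have := ln_ge_pade r1.
  have -> : 2 * (3 / 2 - 1) / (3 / 2 + 1) = 2 / 5 :> R by field.
  have h1 : -1 < - (3 / 2 * e) by lra.
  by have := le_ln1Dx h1; lra.
(* Tangent at 9, the smallest value of [k] here, with [ln 9 = 2 ln 3 <= 16 / 7]. *)
have lnk : ln k%:R <= 9 / 7 + k%:R / 9 :> R.
  have n0 : 0 < 9 :> R by [].
  have := ln_le_tangent k0 n0.
  have -> : (9 : R) = 3 ^+ 2 by ring.
  rewrite lnXn // -[ln 3 *+ _]mulr_natl.
  have r1 : 1 <= 3 :> R by lra.
  have := ln_le_pade r1.
  have -> : (3 - 1) * (3 + 5) / (4 * 3 + 2) = 8 / 7 :> R by field.
  lra.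
have lnkp : ln (k%:R * (1 - w)) = ln k%:R + ln (1 - w) by rewrite lnM ?posrE //; lra.
have e01 : 0 <= e <= 1 / 9 by rewrite ltW.
have := deficit1_poly_ge0 e01; rewrite /= -wE.
have ek : e * k%:R = 1 by rewrite mulVf ?gt_eqF.
have c0 : 0 <= e * (3 - 2 * e) / 2 by nra.
have h1 := ler_wpM2l c0 lnk.
have -> : (3 - 2 * e) / 18 = e * (3 - 2 * e) / 2 * (k%:R / 9).
  by rewrite /e; field; rewrite gt_eqF.
have h2 := ler_wpM2l (ltW w0) lna.
have p0 : 0 <= 1 - w by lra.
have h3 := ler_wpM2l p0 lnp.
have : e * (3 - 2 * e) / 2 * ln k%:R = (1 / 2 - w) * ln k%:R by rewrite wE; ring.
rewrite lnkp in hD; lra.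
Qed.

Lemma deficit1_gap (R : realType) (k m : nat) : (5 <= k)%N -> (1 <= m)%N ->
  (m ^ 2 <= k)%N -> 8 / 100 <= ln (k%:R : R) - ln m%:R - deficit k (1 : R).
Proof.
move=> k5 m1 mk; have [k9|k9] := leqP 9 k; first exact: deficit1_gap_large.
apply: deficit1_gap_small; first by rewrite k5.
rewrite m1 leqNgt; apply/negP => m3.
by have := leq_trans (leq_ltn_trans mk k9) (leq_mul m3 m3); rewrite ltnn.
Qed.

(** * The pointwise lower bound *)

Definition entropy (R : realType) (x : R) := - xlogx x - xlogx (1 - x).

Lemma xlogx0 (R : realType) : xlogx (0 : R) = 0.
Proof. by rewrite /xlogx mul0r. Qed.

Lemma xlogxM (R : realType) (x y : R) : 0 <= x -> 0 <= y ->
  xlogx (x * y) = y * xlogx x + x * xlogx y.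
Proof.
rewrite !le0r => /predU1P[->|x0]; first by rewrite !(mul0r, xlogx0, mulr0, addr0).
move=> /predU1P[->|y0]; first by rewrite !(mul0r, xlogx0, mulr0, addr0).
by rewrite /xlogx lnM //; ring.
Qed.

Lemma xlogx_ge (R : realType) (x : R) : 0 <= x -> x - 1 <= xlogx x.
Proof.
rewrite le0r => /predU1P[->|x0]; first by rewrite xlogx0; lra.
have i0 : 0 < x^-1 by rewrite invr_gt0.
have h : -1 < x^-1 - 1 by lra.
have := ler_wpM2l (ltW x0) (le_ln1Dx h).
rewrite (addrC 1) subrK lnV // mulrN mulrBr mulfV ?gt_eqF // /xlogx; lra.
Qed.

Lemma xlogx_le0 (R : realType) (x : R) : x <= 1 -> xlogx x <= 0.
Proof.
move=> x1; have [x0|x0] := leP x 0; first by rewrite /xlogx ln0 ?mulr0.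
by rewrite /xlogx pmulr_rle0 // ln_le0.
Qed.

(** From [ln u <= u - 1] one gets [entropy x >= 2 x (1 - x)], while
    [2 * slack x <= 9 / 5 * x (1 - x)]. *)
Lemma slack_le_entropy (R : realType) (x : R) : 0 <= x <= 1 ->
  2 * slack x <= entropy x.
Proof.
move=> /andP[x0 x1]; have y0 : 0 <= 1 - x by lra.
have ineq (u : R) : 0 <= u -> u <= 1 -> xlogx u <= u * (u - 1).
  rewrite le0r => /predU1P[->|u0]; first by rewrite xlogx0 mul0r.
  move=> u1; rewrite /xlogx ler_wpM2l ?(ltW u0) //.
  have h : -1 < u - 1 by lra.
  by have := le_ln1Dx h; rewrite (addrC 1) subrK.
have h1 := ineq _ x0 x1.
have h2 : xlogx (1 - x) <= (1 - x) * (1 - x - 1) by apply: ineq; lra.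
have : 0 <= x * (1 - x) * x by rewrite !mulr_ge0.
have : 0 <= x * (1 - x) by rewrite !mulr_ge0.
rewrite /entropy /slack; lra.
Qed.

Lemma h_kmE (R : realType) (k m : nat) (x : R) : (0 < k)%N -> 0 <= x ->
  h_km k m (x / k%:R) = entropy x + x * ln k%:R + (1 - x) * ln m%:R.
Proof.
move=> k0 x0; have k0R : 0 < k%:R :> R by rewrite ltr0n.
rewrite /h_km /entropy.
have -> : k%:R * (x / k%:R) = x by field; rewrite gt_eqF.
have -> : x * ln (x / k%:R) = xlogx x - x * ln k%:R.
  move: x0; rewrite le0r => /predU1P[->|x0]; first by rewrite xlogx0 !mul0r subrr.
  by rewrite /xlogx ln_div ?posrE //; ring.
ring.
Qed.

(** Chain rule for entropy: the outcome is first tested for being zero, with probability [1 - s];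
    given that it is nonzero, its law on [k] points has entropy [ln k - deficit k r]. *)
Lemma g_kmE (R : realType) (k m : nat) (x y : R) : (5 <= k)%N ->
  0 <= x <= 1 -> 0 <= y <= 1 ->
  let s := x + y - x * y in
  g_km k m (x / k%:R) (y / k%:R) =
  - xlogx (1 - s) - xlogx s + s * ln k%:R - s * deficit k (x * y / s)
  + (1 - s) * ln m%:R.
Proof.
move=> k5 /andP[x0 x1] /andP[y0 y1] s.
have k5R : 5 <= k%:R :> R by rewrite ler_nat.
have k0 : 0 < k%:R :> R by lra.
have n0 : k%:R != 0 :> R by rewrite gt_eqF.
have cancel (u : R) : k%:R * (u / k%:R) = u by field.
rewrite /g_km !cancel.
have -> : (1 - x) * (1 - y) = 1 - s by rewrite /s; ring.
have xy0 : 0 <= x * y by rewrite mulr_ge0.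
have sge0 : 0 <= s by rewrite /s; nra.
have xys : x * y <= s by rewrite /s; nra.
pose r := x * y / s; rewrite -/r.
(* This also holds at [s = 0], where [x y <= s] forces [x y = 0]. *)
have rs : s * r = x * y.
  rewrite /r mulrC; have [s0|?] := eqVneq s 0; last by rewrite mulfVK.
  by rewrite s0 mulr0; apply/esym/eqP; rewrite eq_le xy0 -s0 xys.
have r0 : 0 <= r by rewrite divr_ge0.
have r1 : r <= 1.
  rewrite /r; have [s0|sn0] := eqVneq s 0; first by rewrite s0 invr0 mulr0.
  by rewrite ler_pdivrMr ?mul1r // lt0r sn0.
have sk0 : 0 <= s / k%:R by rewrite divr_ge0 // ltW.
have pE (b : R) : 0 <= 1 + r * b ->
    xlogx (s / k%:R * (1 + r * b)) =
    (1 + r * b) * xlogx (s / k%:R) + s / k%:R * xlogx (1 + r * b).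
  by move=> h; rewrite xlogxM.
have top0 : 0 <= 1 + r * top_dev R k.
  have : k%:R^-1 <= 1 :> R by rewrite invf_le1 //; lra.
  by rewrite /top_dev; nra.
have low0 j : (1 <= j < k)%N -> 0 <= 1 + r * - low_dev R k j.
  by move=> hj; have /andP[? ?] := low_dev_bounds R hj; nra.
have topE : x / k%:R + y / k%:R + (k%:R * (k%:R - 1) / 2 - 1) * (x / k%:R) * (y / k%:R) =
    s / k%:R * (1 + r * top_dev R k).
  have -> : s / k%:R * (1 + r * top_dev R k) = (s + (s * r) * top_dev R k) / k%:R by field.
  by rewrite rs /s /top_dev; field.
have lowE j : x / k%:R + y / k%:R - (2 * k%:R - j%:R + 1) * (x / k%:R) * (y / k%:R) =
    s / k%:R * (1 + r * - low_dev R k j).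
  have -> : s / k%:R * (1 + r * - low_dev R k j) =
      (s + (s * r) * - low_dev R k j) / k%:R by field.
  by rewrite rs /s /low_dev; field.
rewrite topE pE //.
under eq_bigr do rewrite lowE.
have -> : \sum_(1 <= j < k) xlogx (s / k%:R * (1 + r * - low_dev R k j)) =
  (k%:R - (1 + r * top_dev R k)) * xlogx (s / k%:R)
  + s / k%:R * \sum_(1 <= j < k) xlogx (1 + r * - low_dev R k j).
  (* The deviations of the [k] nonzero outcomes add up to 0. *)
  have -> : k%:R - (1 + r * top_dev R k) = \sum_(1 <= j < k) (1 + r * - low_dev R k j).
    have H n : \sum_(1 <= j < n.+1) (k%:R + 1 - j%:R) =
        n%:R * (k%:R + 1) - n%:R * (n%:R + 1) / 2 :> R.
      elim: n => [|n IH]; first by rewrite big_nil; ring.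
      by rewrite big_nat_recr //= IH -!natr1; field.
    rewrite big_split /= -mulr_sumr sumrN /low_dev -mulr_suml sumr_const_nat.
    case: k k5 k5R k0 n0 H {cancel pE top0 low0 topE lowE sk0} => // n _ _ _ n0 H.
    rewrite H subn1 /=.
    rewrite /top_dev; move: n0; rewrite -[n.+1%:R]natr1 => n0.
    rewrite -mulr_natr; field.
    by [].
  rewrite mulr_suml mulr_sumr -big_split /= big_nat [RHS]big_nat.
  by apply: eq_bigr => j hj; rewrite pE ?low0.
rewrite /deficit.
have -> : xlogx (s / k%:R) = (xlogx s - s * ln k%:R) / k%:R.
  have [->|sn0] := eqVneq s 0; first by rewrite mul0r !xlogx0 mul0r subrr mul0r.
  have s0 : 0 < s by rewrite lt0r sn0.
  by rewrite /xlogx ln_div ?posrE //; field.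
by field.
Qed.

(** This function and the next enter the bound once for [x] and once for [y], so the constant [ln m]
    and the coefficient of [x y] are halved. *)
Definition lower_diag (R : realType) (k m : nat) (x : R) : R :=
  entropy x - slack x - 4 / 100 * x + ln m%:R / 2 + x * (ln k%:R - ln m%:R).

Definition lower_cross (R : realType) (k m : nat) (x : R) : R :=
  2 * slack x - entropy x
  + x * ((8 / 100 - deficit k 1 - (ln k%:R - ln m%:R)) / 2).

(* The lower bound is a sum of products of a function of [x] and a function of [y],
   so that its expectation only depends on the means of [entropy], [slack] and [x]. *)
Lemma g_km_ge (R : realType) (k m : nat) (x y : R) : (5 <= k)%N ->
  0 <= x <= 1 -> 0 <= y <= 1 ->
  lower_diag k m x + lower_diag k m y + (lower_cross k m x * y + x * lower_cross k m y)
  <= g_km k m (x / k%:R) (y / k%:R).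
Proof.
move=> k5 x01 y01; rewrite g_kmE //=; have := join_gap_ge0 x01 y01.
move: x01 y01 => /andP[x0 x1] /andP[y0 y1].
rewrite /join_gap; set s := x + y - x * y.
have xy0 : 0 <= x * y by rewrite mulr_ge0.
have s0 : 0 <= s by rewrite /s; nra.
have xys : x * y <= s by rewrite /s; nra.
pose r := x * y / s; rewrite -/r.
have rs : s * r = x * y.
  rewrite /r mulrC; have [sE|?] := eqVneq s 0; last by rewrite mulfVK.
  by rewrite sE mulr0; apply/esym/eqP; rewrite eq_le xy0 -sE xys.
have r01 : 0 <= r <= 1.
  rewrite divr_ge0 //= /r; have [sE|sn0] := eqVneq s 0; first by rewrite sE invr0 mulr0.
  by rewrite ler_pdivrMr ?mul1r // lt0r sn0.
have -> : x * y * (x + y - 2 * (x * y)) / s = s * r * (1 - r).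
  have -> : x + y - 2 * (x * y) = s - s * r by rewrite rs /s; ring.
  have [->|sn0] := eqVneq s 0; first by rewrite invr0 !(mulr0, mul0r).
  by rewrite -rs; field.
have := ler_wpM2l s0 (deficit_chord k5 r01).
have -> : s * (r * deficit k 1 - deficit k r) = x * y * deficit k 1 - s * deficit k r.
  by rewrite mulrBr mulrA rs.
have -> : xlogx (1 - s) = (1 - y) * xlogx (1 - x) + (1 - x) * xlogx (1 - y).
  have -> : 1 - s = (1 - x) * (1 - y) by rewrite /s; ring.
  by rewrite xlogxM // subr_ge0.
rewrite /lower_diag /lower_cross /entropy.
have -> : x * (1 - y) * ln x = (1 - y) * xlogx x by rewrite /xlogx; ring.
have -> : y * (1 - x) * ln y = (1 - x) * xlogx y by rewrite /xlogx; ring.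
have -> : s * ln s = xlogx s by [].
rewrite (_ : s * ln k%:R = (x + y - x * y) * ln k%:R) //.
rewrite (_ : (1 - s) * ln m%:R = (1 - (x + y - x * y)) * ln m%:R) //.
(* The difference of the two sides is [join_gap x y] plus [s] times the excess in
   [deficit_chord]. *)
lra.
Qed.

(** * Expectations *)

(** Stable under sums, products and measurable substitutions, and sufficient for integrability under
    any probability. *)
Definition bounded_measurable d (T : measurableType d) (R : realType) (f : T -> R) : Prop :=
  measurable_fun setT f /\ exists M, forall x, `|f x| <= M.

Lemma bounded_measurable_cst d (T : measurableType d) (R : realType) (a : R) :
  bounded_measurable (fun _ : T => a).
Proof. by split; [exact: measurable_cst|exists `|a|]. Qed.

Lemma bounded_measurableD d (T : measurableType d) (R : realType) (f g : T -> R) :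
  bounded_measurable f -> bounded_measurable g ->
  bounded_measurable (fun x => f x + g x).
Proof.
move=> [mf [M hM]] [mg [N hN]]; split; first exact: measurable_funD.
by exists (M + N) => x; rewrite (le_trans (ler_normD _ _)) ?lerD.
Qed.

Lemma bounded_measurableM d (T : measurableType d) (R : realType) (f g : T -> R) :
  bounded_measurable f -> bounded_measurable g ->
  bounded_measurable (fun x => f x * g x).
Proof.
move=> [mf [M hM]] [mg [N hN]]; split; first exact: measurable_funM.
by exists (M * N) => x; rewrite normrM ler_pM.
Qed.

Lemma bounded_measurable_comp d d' (T : measurableType d) (T' : measurableType d')
    (R : realType) (f : T -> R) (h : T' -> T) :
  measurable_fun setT h -> bounded_measurable f -> bounded_measurable (fun x => f (h x)).
Proof.
by move=> mh [mf [M hM]]; split; [exact: (measurableT_comp mf mh)|exists M].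
Qed.

Lemma bounded_measurable_integrable d (T : measurableType d) (R : realType)
    (P : probability T R) (f : T -> R) :
  bounded_measurable f -> P.-integrable setT (EFin \o f).
Proof.
move=> [mf [M hM]]; apply: measurable_bounded_integrable => //.
  exact: le_lt_trans (probability_le1 P measurableT) (ltry _).
by exists M; split => [|N MN x _]; [exact: num_real|exact: le_trans (hM x) (ltW MN)].
Qed.

Lemma expectation_Rintegral d (T : measurableType d) (R : realType)
    (P : probability T R) (f : T -> R) :
  bounded_measurable f -> ('E_P[f] = (\int[P]_x f x)%R%:E)%E.
Proof.
move=> bf; rewrite unlock /Rintegral fineK //.
exact: integrable_fin_num (bounded_measurable_integrable P bf).
Qed.

Lemma Rintegral_probability_cst d (T : measurableType d) (R : realType)
    (P : probability T R) (a : R) : \int[P]_x a = a.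
Proof.
apply: EFin_inj; rewrite -(expectation_Rintegral P (bounded_measurable_cst T a)).
exact: expectation_cst.
Qed.

Lemma RintegralD_bounded d (T : measurableType d) (R : realType)
    (P : probability T R) (f g : T -> R) :
  bounded_measurable f -> bounded_measurable g ->
  \int[P]_x (f x + g x) = \int[P]_x f x + \int[P]_x g x.
Proof. by move=> bf bg; rewrite RintegralD //; exact: bounded_measurable_integrable. Qed.

Lemma RintegralZ_bounded d (T : measurableType d) (R : realType)
    (P : probability T R) (f : T -> R) (a : R) :
  bounded_measurable f -> \int[P]_x (a * f x) = a * \int[P]_x f x.
Proof. by move=> bf; rewrite RintegralZl //; exact: bounded_measurable_integrable. Qed.

Lemma Rintegral_prod d d' (T : measurableType d) (T' : measurableType d') (R : realType)
    (P : probability T R) (Q : probability T' R) (f : T -> R) (g : T' -> R) :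
  bounded_measurable f -> bounded_measurable g ->
  \int[(P \x Q)%E]_z (f z.1 * g z.2) = (\int[P]_x f x) * (\int[Q]_y g y).
Proof.
move=> bf bg.
have bfg : bounded_measurable (fun z : T * T' => f z.1 * g z.2).
  by apply: bounded_measurableM; exact: bounded_measurable_comp.
rewrite [LHS]/Rintegral -integral12_prod_meas1; last first.
  exact: (@bounded_measurable_integrable _ _ _ (P \x Q)%E _ bfg).
rewrite mulrC -RintegralZ_bounded // /Rintegral; congr fine; apply: eq_integral => x _.
transitivity (\int[Q]_y (f x * g y))%:E; last by rewrite RintegralZ_bounded // mulrC.
rewrite /Rintegral fineK //; apply: integrable_fin_num => //.
apply: (@bounded_measurable_integrable _ _ _ Q (fun y => f x * g y)).
by apply: bounded_measurableM => //; exact: bounded_measurable_cst.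
Qed.

Lemma eq_expectation_full d (T : measurableType d) (R : realType)
    (P : probability T R) (A : set T) (f g : T -> R) :
  measurable A -> P A = 1%E -> measurable_fun setT f -> measurable_fun setT g ->
  {in A, f =1 g} -> ('E_P[f] = 'E_P[g])%E.
Proof.
move=> mA PA mf mg fg; rewrite unlock; apply: ae_eq_integral => //.
- exact/measurable_EFinP.
- exact/measurable_EFinP.
exists (~` A); split; first exact: measurableC.
  by have := probability_setC P mA; rewrite PA subee.
move=> x /= h Ax; apply: h => _; congr EFin; apply: fg; exact/mem_set.
Qed.

(** * Measurability and bounds of the integrands *)

Lemma measurable_xlogx (R : realType) : measurable_fun setT (@xlogx R).
Proof. by apply: measurable_funM => //; exact: measurable_ln. Qed.

Lemma measurable_g_km (R : realType) (k m : nat) (f g : R * R -> R) :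
  measurable_fun setT f -> measurable_fun setT g ->
  measurable_fun setT (fun z => g_km k m (f z) (g z)).
Proof.
move=> mf mg.
have mc (a : R) : measurable_fun setT (fun _ : R * R => a) by exact: measurable_cst.
have mx (h : R * R -> R) : measurable_fun setT h -> measurable_fun setT (fun z => xlogx (h z)).
  by move=> mh; exact: (measurableT_comp (@measurable_xlogx R) mh).
have mk (h : R * R -> R) : measurable_fun setT h -> measurable_fun setT (fun z => 1 - k%:R * h z).
  by move=> mh; apply: measurable_funB => //; exact: measurable_funM.
rewrite /g_km; apply: measurable_funD; last first.
  by apply: measurable_funM => //; apply: measurable_funM; exact: mk.
apply: measurable_funB; last first.
  apply: measurable_sum => j; apply: mx; apply: measurable_funB; first exact: measurable_funD.
  by apply: measurable_funM => //; exact: measurable_funM.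
apply: measurable_funB.
  by apply: measurable_funN; apply: mx; apply: measurable_funM; exact: mk.
apply: mx; apply: measurable_funD; first exact: measurable_funD.
by apply: measurable_funM => //; exact: measurable_funM.
Qed.

(** Points outside [[0, 1]] go to 0. The pointwise bounds then hold on the whole line, and a measure
    carried by [[0, 1]] does not see the change. *)
Definition clamp (R : realType) (x : R) : R := x * \1_`[0, 1]%classic x.

Lemma clamp_id (R : realType) (x : R) : 0 <= x <= 1 -> clamp x = x.
Proof.
by move=> x01; rewrite /clamp indicE mem_set ?mulr1 //= in_itv.
Qed.

Lemma clamp01 (R : realType) (x : R) : 0 <= clamp x <= 1.
Proof.
have [x01|x01] := boolP (0 <= x <= 1); first by rewrite clamp_id.
by rewrite /clamp indicE memNset ?mulr0 ?lexx ?ler01 //= in_itv /=; exact/negP.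
Qed.

Lemma measurable_clamp (R : realType) : measurable_fun setT (@clamp R).
Proof. by apply: measurable_funM => //; exact: measurable_indic. Qed.

Lemma bounded_measurable_clamp (R : realType) : bounded_measurable (@clamp R).
Proof.
split; first exact: measurable_clamp.
by exists 1 => x; have /andP[c0 c1] := clamp01 x; rewrite ger0_norm.
Qed.

Lemma entropy01 (R : realType) (x : R) : 0 <= x <= 1 -> 0 <= entropy x <= 1.
Proof.
move=> /andP[x0 x1]; have y0 : 0 <= 1 - x by lra.
have y1 : 1 - x <= 1 by lra.
have := xlogx_ge x0; have := xlogx_ge y0; have := xlogx_le0 x1; have := xlogx_le0 y1.
rewrite /entropy => ? ? ? ?; apply/andP; split; lra.
Qed.

Lemma bounded_measurable_entropy (R : realType) :
  bounded_measurable (fun x : R => entropy (clamp x)).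
Proof.
split; last by exists 1 => x; have /andP[c0 c1] := entropy01 (clamp01 x); rewrite ger0_norm.
have mx (h : R -> R) : measurable_fun setT h -> measurable_fun setT (fun z => xlogx (h z)).
  by move=> mh; exact: (measurableT_comp (@measurable_xlogx R) mh).
apply: measurable_funB; first by apply: measurable_funN; apply: mx; exact: measurable_clamp.
by apply: mx; apply: measurable_funB => //; exact: measurable_clamp.
Qed.

Lemma bounded_measurable_slack (R : realType) :
  bounded_measurable (fun x : R => slack (clamp x)).
Proof.
have bc := @bounded_measurable_clamp R.
have cst (a : R) : bounded_measurable (fun _ : R => a) by exact: bounded_measurable_cst.
rewrite /slack; apply: bounded_measurableM; last first.
  by apply: bounded_measurableD => //;
    under eq_fun do rewrite -mulNr; exact: bounded_measurableM.
apply: bounded_measurableM; first exact: bounded_measurableM.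
by apply: bounded_measurableD => //;
    under eq_fun do rewrite -mulN1r; exact: bounded_measurableM.
Qed.

(** All arguments of [xlogx] are at most 1, so no term is negative. This makes [ge0_expectation_ge]
    applicable to [g_km]. *)
Lemma g_km_ge0 (R : realType) (k m : nat) (x y : R) : (5 <= k)%N -> (1 <= m)%N ->
  0 <= x <= 1 -> 0 <= y <= 1 -> 0 <= g_km k m (x / k%:R) (y / k%:R).
Proof.
move=> k5 m1 /andP[x0 x1] /andP[y0 y1].
have k5R : 5 <= k%:R :> R by rewrite ler_nat.
have k0 : 0 < k%:R :> R by lra.
have cancel (u : R) : k%:R * (u / k%:R) = u by field; rewrite gt_eqF.
have e0 : 0 < k%:R^-1 :> R by rewrite invr_gt0.
have e1 : k%:R^-1 <= 1 / 5 :> R by rewrite -div1r ler_pdivrMr //; lra.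
have lnm : 0 <= ln m%:R :> R by rewrite ln_ge0 // ler1n.
rewrite /g_km !cancel.
have p0 : 0 <= (1 - x) * (1 - y) by nra.
have h1 : xlogx ((1 - x) * (1 - y)) <= 0 by apply: xlogx_le0; nra.
have h2 : xlogx (x / k%:R + y / k%:R
    + (k%:R * (k%:R - 1) / 2 - 1) * (x / k%:R) * (y / k%:R)) <= 0.
  apply: xlogx_le0; set e : R := k%:R^-1 in e0 e1 *.
  have -> : x * e + y * e + (k%:R * (k%:R - 1) / 2 - 1) * (x * e) * (y * e) =
      (x + y) * e + (1 / 2 - e / 2 - e ^+ 2) * (x * y).
    by rewrite /e; field; rewrite gt_eqF.
  nra.
have h3 : \sum_(1 <= j < k) xlogx (x / k%:R + y / k%:R -
    (2 * k%:R - j%:R + 1) * (x / k%:R) * (y / k%:R)) <= 0.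
  rewrite big_nat; apply: sumr_le0 => j /andP[j1 jk]; apply: xlogx_le0.
  have jkR : j%:R <= k%:R :> R by rewrite ler_nat ltnW.
  have q0 : 0 <= (2 * k%:R - j%:R + 1) * (x / k%:R) * (y / k%:R).
    by rewrite !mulr_ge0 // ?(ltW e0) //; lra.
  nra.
have := mulr_ge0 p0 lnm; lra.
Qed.

Lemma measurable_h_km (R : realType) (k m : nat) :
  measurable_fun setT (fun x : R => h_km k m (x / k%:R)).
Proof.
have mt : measurable_fun setT (fun x : R => x / k%:R) by exact: measurable_funM.
have mk : measurable_fun setT (fun x : R => 1 - k%:R * (x / k%:R)).
  by apply: measurable_funB => //; exact: measurable_funM.
rewrite /h_km; apply: measurable_funD; last exact: measurable_funM.
apply: measurable_funB; last exact: (measurableT_comp (@measurable_xlogx R) mk).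
apply: measurable_funN; apply: measurable_funM; first exact: measurable_funM.
exact: (measurableT_comp (@measurable_ln R) mt).
Qed.

(** The positive part of [f] lies between [f] and [g], and for nonnegative functions monotonicity of
    the integral only asks for measurability. *)
Lemma ge0_expectation_ge d (T : measurableType d) (R : realType)
    (P : probability T R) (f g : T -> R) :
  bounded_measurable f -> measurable_fun setT g -> (forall x, 0 <= g x) ->
  (forall x, f x <= g x) -> ((\int[P]_x f x)%R%:E <= 'E_P[g])%E.
Proof.
move=> bf mg g0 fg; rewrite -expectation_Rintegral // unlock.
have intf := bounded_measurable_integrable P bf.
apply: (@le_trans _ _ (\int[P]_x ((EFin \o f)^\+ x))%E).
  apply: le_integral => //; first exact: integrable_funepos.
  by move=> x _; rewrite funeposE /= le_max lexx.
apply: ge0_le_integral => //.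
- by apply: measurable_funepos; apply/measurable_EFinP; exact: bf.1.
- exact/measurable_EFinP.
- by move=> x _; rewrite funeposE /= ge_max !lee_fin fg g0.
Qed.

Lemma expectation_h_km (R : realType) (k m : nat) (phi : R)
    (mu : probability (measurableTypeR R) R) : (0 < k)%N -> probs_unit_itv mu ->
  \int[mu]_x clamp x = phi ->
  ('E_mu[fun x : R => h_km k m (x / k%:R)] =
   (\int[mu]_x entropy (clamp x) + phi * ln k%:R + (1 - phi) * ln m%:R)%R%:E)%E.
Proof.
move=> k0 mu01 <-.
have bc := @bounded_measurable_clamp R; have be := @bounded_measurable_entropy R.
have cst (a : R) : bounded_measurable (fun _ : measurableTypeR R => a)
  by exact: bounded_measurable_cst.
pose h (x : R) := entropy (clamp x) + ((ln k%:R - ln m%:R) * clamp x + ln m%:R).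
have b1 : bounded_measurable (fun x : R => (ln k%:R - ln m%:R) * clamp x).
  exact: bounded_measurableM (cst _) bc.
have b2 : bounded_measurable (fun x : R => (ln k%:R - ln m%:R) * clamp x + ln m%:R).
  exact: bounded_measurableD b1 (cst _).
have bh : bounded_measurable h by exact: bounded_measurableD be b2.
rewrite (@eq_expectation_full _ _ _ mu `[0, 1]%classic _ h) //.
- rewrite expectation_Rintegral // (RintegralD_bounded mu be b2) /=.
  rewrite (RintegralD_bounded mu b1 (cst _)) /= (RintegralZ_bounded mu _ bc).
  rewrite Rintegral_probability_cst; congr EFin; ring.
- exact: measurable_h_km.
- exact: bh.1.
move=> x; rewrite inE /= in_itv /= => x01; rewrite h_kmE ?(andP x01).1 // /h clamp_id //.
ring.
Qed.

(** The bound of [g_km_ge] is integrated: with [u] and [v] its diagonal and cross functions,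
    independence of the coordinates gives [2 E[u] + 2 phi E[v]]. *)
Lemma expectation_g_km_ge (R : realType) (k m : nat) (phi : R)
    (mu : probability (measurableTypeR R) R) : (5 <= k)%N -> (1 <= m)%N ->
  probs_unit_itv mu -> \int[mu]_x clamp x = phi ->
  ((2 * (1 - phi) * (\int[mu]_x entropy (clamp x))
    - 2 * (1 - 2 * phi) * (\int[mu]_x slack (clamp x)) + ln m%:R
    + (2 * phi - phi ^+ 2) * (ln k%:R - ln m%:R)
    - 8 / 100 * (phi * (1 - phi)) - phi ^+ 2 * deficit k 1)%R%:E <=
  'E_(mu \x mu)[fun z : R * R => g_km k m (z.1 / k%:R) (z.2 / k%:R)])%E.
Proof.
move=> k5 m1 mu01 mean.
set EH := \int[mu]_x entropy (clamp x); set ES := \int[mu]_x slack (clamp x).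
have bc := @bounded_measurable_clamp R; have be := @bounded_measurable_entropy R.
have bs := @bounded_measurable_slack R.
have cst (a : R) : bounded_measurable (fun _ : measurableTypeR R => a)
  by exact: bounded_measurable_cst.
set L := ln k%:R - ln m%:R; set D := deficit k 1.
pose u (x : R) := entropy (clamp x) + ((-1) * slack (clamp x)
  + ((L - 4 / 100) * clamp x + ln m%:R / 2)).
pose v (x : R) := (-1) * entropy (clamp x) + (2 * slack (clamp x)
  + (8 / 100 - D - L) / 2 * clamp x).
have scale (a : R) (f : R -> R) : bounded_measurable f ->
    bounded_measurable (fun x => a * f x).
  by move=> bf; exact: bounded_measurableM (cst _) bf.
have bu1 : bounded_measurable (fun x : R => (L - 4 / 100) * clamp x + ln m%:R / 2).
  exact: bounded_measurableD (scale _ _ bc) (cst _).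
have bu2 : bounded_measurable (fun x : R => (-1) * slack (clamp x)
    + ((L - 4 / 100) * clamp x + ln m%:R / 2)).
  exact: bounded_measurableD (scale _ _ bs) bu1.
have bu : bounded_measurable u by exact: bounded_measurableD be bu2.
have bv1 : bounded_measurable (fun x : R => 2 * slack (clamp x)
    + (8 / 100 - D - L) / 2 * clamp x).
  exact: bounded_measurableD (scale _ _ bs) (scale _ _ bc).
have bv : bounded_measurable v by exact: bounded_measurableD (scale _ _ be) bv1.
have Eu : \int[mu]_x u x = EH - ES + (L - 4 / 100) * phi + ln m%:R / 2.
  rewrite (RintegralD_bounded mu be bu2) /= (RintegralD_bounded mu (scale _ _ bs) bu1) /=.
  rewrite (RintegralD_bounded mu (scale _ _ bc) (cst _)) /=.
  rewrite (RintegralZ_bounded mu _ bs) (RintegralZ_bounded mu _ bc).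
  by rewrite mean Rintegral_probability_cst /EH /ES; ring.
have Ev : \int[mu]_x v x = - EH + 2 * ES + (8 / 100 - D - L) / 2 * phi.
  rewrite (RintegralD_bounded mu (scale _ _ be) bv1) /=.
  rewrite (RintegralD_bounded mu (scale _ _ bs) (scale _ _ bc)) /=.
  rewrite (RintegralZ_bounded mu _ be) (RintegralZ_bounded mu _ bs)
    (RintegralZ_bounded mu _ bc).
  by rewrite mean /EH /ES; ring.
(* The factors 1 give every term the product shape of [Rintegral_prod]. *)
pose T (z : R * R) := (u z.1 * 1 + 1 * u z.2) + (v z.1 * clamp z.2 + clamp z.1 * v z.2).
have prodB (f g : R -> R) : bounded_measurable f -> bounded_measurable g ->
    bounded_measurable (fun z : R * R => f z.1 * g z.2).
  move=> bf bg; exact: (bounded_measurableM (bounded_measurable_comp measurable_fst bf)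
    (bounded_measurable_comp measurable_snd bg)).
have c1 := cst 1.
have bT1 : bounded_measurable (fun z : R * R => u z.1 * 1 + 1 * u z.2).
  exact: bounded_measurableD (prodB _ _ bu c1) (prodB _ _ c1 bu).
have bT2 : bounded_measurable (fun z : R * R => v z.1 * clamp z.2 + clamp z.1 * v z.2).
  exact: bounded_measurableD (prodB _ _ bv bc) (prodB _ _ bc bv).
have bT : bounded_measurable T by exact: bounded_measurableD bT1 bT2.
have ET : \int[(mu \x mu)%E]_z T z = 2 * (\int[mu]_x u x) + 2 * phi * (\int[mu]_x v x).
  rewrite (RintegralD_bounded (mu \x mu)%E bT1 bT2) /=.
  rewrite (RintegralD_bounded (mu \x mu)%E (prodB _ _ bu c1) (prodB _ _ c1 bu)) /=.
  rewrite (RintegralD_bounded (mu \x mu)%E (prodB _ _ bv bc) (prodB _ _ bc bv)) /=.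
  rewrite (Rintegral_prod mu mu bu c1) (Rintegral_prod mu mu c1 bu).
  rewrite (Rintegral_prod mu mu bv bc) (Rintegral_prod mu mu bc bv).
  by rewrite mean Rintegral_probability_cst; ring.
pose I : set R := `[0, 1]%classic.
have muI : mu I = 1%E := mu01.
have mz1 : measurable_fun setT (fun z : R * R => z.1 / k%:R) by exact: measurable_funM.
have mz2 : measurable_fun setT (fun z : R * R => z.2 / k%:R) by exact: measurable_funM.
have mc1 : measurable_fun setT (fun z : R * R => clamp z.1 / k%:R).
  by apply: measurable_funM => //; exact: measurableT_comp (@measurable_clamp R) _.
have mc2 : measurable_fun setT (fun z : R * R => clamp z.2 / k%:R).
  by apply: measurable_funM => //; exact: measurableT_comp (@measurable_clamp R) _.
rewrite (@eq_expectation_full _ _ _ (mu \x mu)%E (I `*` I) _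
   (fun z : R * R => g_km k m (clamp z.1 / k%:R) (clamp z.2 / k%:R))); last first.
- move=> [x y]; rewrite inE => -[]; rewrite /I /= !in_itv /= => x01 y01.
  by rewrite !clamp_id.
- exact: measurable_g_km.
- exact: measurable_g_km.
- transitivity (mu I * mu I)%E; last by rewrite muI mule1.
  by apply: product_measure1E; exact: measurable_itv.
- by apply: measurableX; exact: measurable_itv.
apply: le_trans (ge0_expectation_ge (mu \x mu)%E bT _ _ _).
- by rewrite ET Eu Ev lee_fin le_eqVlt; apply/orP; left; apply/eqP; field.
- exact: measurable_g_km.
- by move=> z; rewrite g_km_ge0 // clamp01.
move=> z; apply: le_trans (g_km_ge m k5 (clamp01 z.1) (clamp01 z.2)).
rewrite le_eqVlt; apply/orP; left; apply/eqP.
by rewrite /T /u /v /lower_diag /lower_cross -/L -/D; field.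
Qed.

Theorem theorem1p6 (R : realType) (k m : nat) (hk : (5 <= k)%N)
    (hm1 : (1 <= m)%N) (hmk : m%:R <= Num.sqrt (k%:R : R))
    (phi : R) (hphi0 : 0 < phi) (hphi : phi < 1 / 2)
    (mu : probability (measurableTypeR R) R) (hmu : probs_mean phi mu) :
  (0 < F_km k m mu)%E.
Proof.
have [mu01 Emu] := hmu.
have k0 : (0 < k)%N by apply: leq_trans hk.
have mk : (m ^ 2 <= k)%N.
  rewrite -(ler_nat R) natrX -[leRHS]sqr_sqrtr ?ler0n //.
  by rewrite ler_pXn2r ?nnegrE ?ler0n ?sqrtr_ge0.
have bc := @bounded_measurable_clamp R.
have mean : \int[mu]_x clamp x = phi.
  apply: EFin_inj; rewrite -expectation_Rintegral // -Emu.
  apply: (@eq_expectation_full _ _ _ mu `[0, 1]%classic) => //; first exact: bc.1.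
  by move=> x; rewrite inE /= in_itv /= => x01; rewrite clamp_id.
have := @expectation_g_km_ge _ k m phi mu hk hm1 mu01 mean.
rewrite /F_km (@expectation_h_km _ _ _ _ _ k0 mu01 mean).
set EH := \int[mu]_x entropy (clamp x); set ES := \int[mu]_x slack (clamp x) => hg.
rewrite sube_gt0; apply: lt_le_trans hg; rewrite lte_fin.
have hES : 2 * ES <= EH.
  have bs := @bounded_measurable_slack R.
  have b2s := bounded_measurableM (bounded_measurable_cst (measurableTypeR R) (2 : R)) bs.
  rewrite /ES -(RintegralZ_bounded mu _ bs); apply: le_Rintegral => //.
  - exact: (bounded_measurable_integrable mu b2s).
  - exact: (bounded_measurable_integrable mu (@bounded_measurable_entropy R)).
  - by move=> x _; rewrite slack_le_entropy // clamp01.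
have hD := deficit1_gap R hk hm1 mk.
set L := ln k%:R - ln m%:R in hD *; set D := deficit k 1 in hD *.
(* In all cases [2 m <= k]: for [m = 1] because [k >= 5], otherwise because [2 m <= m^2]. Hence
   [L >= ln 2 >= 2 / 3]. *)
have hL : 8 / 100 < L.
  have m0 : 0 < m%:R :> R by rewrite ltr0n.
  have km : 2 * m%:R <= k%:R :> R.
    rewrite -natrM ler_nat; case: m hm1 mk {hmk L D hD m0} => [|[|[|n]]] // _ mk.
      by apply: leq_trans hk.
    by apply: leq_trans mk; rewrite expnS expn1 leq_mul2r.
  have h2 : 1 <= 2 :> R by lra.
  have := ln_ge_pade h2.
  have -> : 2 * (2 - 1) / (2 + 1) = 2 / 3 :> R by field.
  have : ln (2 * m%:R) <= ln k%:R :> R by rewrite ler_ln ?posrE ?mulr_gt0 ?ltr0n.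
  rewrite lnM ?posrE // /L; lra.
rewrite -subr_gt0.
have -> : 2 * (1 - phi) * EH - 2 * (1 - 2 * phi) * ES + ln m%:R
    + (2 * phi - phi ^+ 2) * L - 8 / 100 * (phi * (1 - phi)) - phi ^+ 2 * D
    - (EH + phi * ln k%:R + (1 - phi) * ln m%:R) =
  (1 - 2 * phi) * (EH - 2 * ES) + phi ^+ 2 * (L - D - 8 / 100)
  + phi * (1 - 2 * phi) * (L - 8 / 100) by rewrite /L; ring.
have p0 : 0 < 1 - 2 * phi by lra.
(* Strictness comes from the last summand, as [0 < phi < 1 / 2]. *)
apply: ltr_wpDl; last by rewrite mulr_gt0 ?subr_gt0 // mulr_gt0.
by apply: addr_ge0; apply: mulr_ge0; rewrite ?sqr_ge0 ?(ltW p0) //; lra.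
Qed.
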